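(* Let $X$ be a Banach space and let $S,T\in B(X)$ be such that: (a) $ST=TS$ and $N((TS)^p)=N(T^p)\oplus N(S^p)$ for all $p\in\mathbb{N}$; (b) $ST$ has finite descent, equal to $n_0$, and $N(S^{n_0})\subseteq R(T)$ or $N(T^{n_0})\subseteq R(S)$. If $\operatorname{codim} R(S^{n_0})$ and $\operatorname{codim} R(T^{n_0})$ are finite, then $$dsc(T)\le n_0\ \text{ and }\ dsc(S)\le n_0\quad\text{if and only if}\quad dsc(TS)\le n_0.$$
   Context: $B(X)$ is the algebra of bounded linear operators on $X$, and $N(T)$, $R(T)$ denote the null space and range of $T$. $\mathbb{N}=\{0,1,2,\dots\}$. The descent $dsc(T)$ is the smallest $n\in\mathbb{N}$ with $R(T^n)=R(T^{n+1})$, and $dsc(T)=\infty$ if no such $n$ exists. $\operatorname{codim} R(T)=\dim X/R(T)$. The symbol $\oplus$ denotes the (internal algebraic) direct sum of subspaces, so that the equality includes the requirement that the two summands intersect only in $\{0\}$. *)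

(* Defs.v *)
From HB Require Import structures.
From mathcomp Require Import all_boot all_order all_algebra.
From mathcomp Require Import generic_quotient ring_quotient.
From mathcomp Require Import all_classical all_reals all_analysis.

Set Implicit Arguments.
Unset Strict Implicit.
Unset Printing Implicit Defensive.

Import Order.TTheory GRing.Theory Num.Theory.
Import numFieldNormedType.Exports.

Local Open Scope classical_set_scope.
Local Open Scope ring_scope.

Section LinearIter.
Variables (R : pzRingType) (V : lmodType R) (f : {linear V -> V}) (n : nat).

Lemma iter_is_linear : linear (iter n f).
Proof.
by elim: n => [//|m IHm] a u v /=; rewrite IHm linearP.
Qed.

HB.instance Definition _ :=
  GRing.isLinear.Build R V V *:%R (iter n f) iter_is_linear.

End LinearIter.

Section NullSpaceRange.
Variables (R : pzRingType) (V W : lmodType R).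

Definition null_space (f : V -> W) : set V := [set x | f x = 0].

(* The range as a boolean predicate, so that it can carry the algebraic
   closure structure required by the quotients of ring_quotient. *)
Definition range_pred (f : {linear V -> W}) : {pred W} :=
  fun y => `[< range f y >].

Lemma range_pred_submod_closed (f : {linear V -> W}) :
  submod_closed (range_pred f).
Proof.
split; first by apply/asboolP; exists 0; rewrite ?linear0.
move=> a u v /asboolP[x _ <-] /asboolP[y _ <-]; apply/asboolP.
by exists (a *: x + y) => //; rewrite linearP.
Qed.

HB.instance Definition _ (f : {linear V -> W}) :=
  GRing.isSubmodClosed.Build R W (range_pred f) (range_pred_submod_closed f).

End NullSpaceRange.

(* The library only provides the additive group structure of the quotient of
   a module by a submodule; we add the scalar multiplication. *)
Section LmodQuotient.
Variables (R : pzRingType) (V : lmodType R) (W : submodClosed V).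

(* A submodClosed predicate is only registered as stable under addition and
   scaling. *)
Lemma submod_zmod_closed : zmod_closed (W : {pred V}).
Proof.
split; first exact: rpred0.
by move=> u v Wu Wv; rewrite -scaleN1r; apply: rpredD => //; exact: rpredZ.
Qed.

Definition submod_zmod : zmodClosed V :=
  HB.pack (GRing.SubmodClosed.sort W)
    (GRing.isZmodClosed.Build V (GRing.SubmodClosed.sort W) submod_zmod_closed).

Definition lmod_quot : Type := Quotient.quot submod_zmod.

HB.instance Definition _ := Choice.on lmod_quot.
HB.instance Definition _ := GRing.Zmodule.on lmod_quot.

Definition lmod_pi (x : V) : lmod_quot := (\pi_(Quotient.quot submod_zmod) x)%qT.

Definition lmod_quot_scale (a : R) (q : lmod_quot) : lmod_quot :=
  lmod_pi (a *: repr (q : Quotient.quot submod_zmod)).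

Lemma lmod_pi_eq x y : (lmod_pi x = lmod_pi y) <-> (x - y \in W).
Proof.
split=> [|Wxy].
  by move/eqP; rewrite -(@Quotient.idealrBE _ submod_zmod).
by apply/eqP; rewrite -(@Quotient.idealrBE _ submod_zmod).
Qed.

Lemma lmod_piK (q : lmod_quot) : lmod_pi (repr (q : Quotient.quot submod_zmod)) = q.
Proof. exact: reprK. Qed.

Lemma lmod_piD x y : lmod_pi (x + y) = lmod_pi x + lmod_pi y.
Proof. exact: (raddfD \pi_(Quotient.quot submod_zmod)%qT). Qed.

Lemma lmod_piZ a x : lmod_pi (a *: x) = lmod_quot_scale a (lmod_pi x).
Proof.
apply/lmod_pi_eq; rewrite -scalerBr; apply: rpredZ.
by apply/lmod_pi_eq; rewrite lmod_piK.
Qed.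

Lemma lmod_quot_scaleA a b q :
  lmod_quot_scale a (lmod_quot_scale b q) = lmod_quot_scale (a * b) q.
Proof. by rewrite -[q]lmod_piK -!lmod_piZ scalerA. Qed.

Lemma lmod_quot_scale1 : left_id 1 lmod_quot_scale.
Proof. by move=> q; rewrite -[q]lmod_piK -lmod_piZ scale1r. Qed.

Lemma lmod_quot_scaleDr : right_distributive lmod_quot_scale +%R.
Proof.
move=> a p q; rewrite -[p]lmod_piK -[q]lmod_piK.
by rewrite -lmod_piD -!lmod_piZ scalerDr lmod_piD.
Qed.

Lemma lmod_quot_scaleDl q :
  {morph lmod_quot_scale^~ q : a b / a + b}.
Proof.
by move=> a b; rewrite -[q]lmod_piK -!lmod_piZ scalerDl lmod_piD.
Qed.

HB.instance Definition _ := GRing.Zmodule_isLmodule.Build R lmod_quot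
  lmod_quot_scaleA lmod_quot_scale1 lmod_quot_scaleDr lmod_quot_scaleDl.

Lemma lmod_pi_is_linear : linear lmod_pi.
Proof. by move=> a x y; rewrite lmod_piD lmod_piZ. Qed.

HB.instance Definition _ :=
  GRing.isLinear.Build R V lmod_quot *:%R lmod_pi lmod_pi_is_linear.

End LmodQuotient.

Definition finite_dim (R : nzRingType) (V : lmodType R) : Prop :=
  exists n : nat, inhabited (Vector.axiom n V).

(* codim R(f) < oo, where codim R(f) = dim W / R(f). *)
Definition finite_codim_range (R : nzRingType) (V W : lmodType R)
    (f : {linear V -> W}) : Prop :=
  finite_dim (lmod_quot (range_pred f)).

Definition bounded_operator (K : numFieldType) (V W : normedModType K)
    (f : {linear V -> W}) : Prop :=
  exists M : K, forall x : V, `|f x| <= M * `|x|.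

(* C = A (+) B, internal direct sum. *)
Definition is_direct_sum (V : zmodType) (C A B : set V) : Prop :=
  C = [set a + b | a in A & b in B] /\ A `&` B = [set 0].

Definition range_stable_at (X : Type) (f : X -> X) : pred nat :=
  fun n => `[< range (iter n f) = range (iter n.+1 f) >].

(* None stands for an infinite descent. *)
Definition dsc (X : Type) (f : X -> X) : option nat :=
  if pselect (exists n, range_stable_at f n) is left ex
  then Some (ex_minn ex) else None.

Definition dsc_le (d : option nat) (n : nat) : bool :=
  if d is Some m then (m <= n)%N else false.

(* Main.v *)
Require Import Defs.
From HB Require Import structures.
From mathcomp Require Import all_boot all_order all_algebra.
From mathcomp Require Import all_classical all_reals all_analysis.

(* Write n = n0, A = N(T^n), B = N(S^n), W = R((ST)^n); by symmetry assume that
   B is contained in R(T). Finite descent of ST gives X = A + B + W, which yields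
   dsc T <= n at once, and dsc S <= n as soon as A is contained in S A + W.
   Now W has finite codimension and T maps B onto itself, so T is injective on B
   modulo W. From this one derives that S is injective on A modulo W, hence also
   surjective there, again by finite codimension. *)
Set Implicit Arguments.
Unset Strict Implicit.
Unset Printing Implicit Defensive.

Import Order.TTheory GRing.Theory Num.Theory.
Import numFieldNormedType.Exports.

Local Open Scope classical_set_scope.
Local Open Scope ring_scope.

(* Stated by linear dependence modulo W, so that no basis of a quotient has to be
   constructed for a composition. *)
Definition finite_codim_pred (F : fieldType) (V : lmodType F) (W : {pred V}) :=
  exists I : finType, forall x : I -> V,
    exists2 c : I -> F, (exists i, c i != 0) & \sum_i c i *: x i \in W.

(** * Linear dependence modulo a subspace of finite codimension *)

Section FiniteCodimension.
Variables (F : fieldType) (V : lmodType F).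
Implicit Types (f g : {linear V -> V}) (W : submodClosed V).

Lemma range_predP f y : reflect (exists x, f x = y) (y \in range_pred f).
Proof. by apply: (iffP (asboolP _)) => -[x]; [move=> _ <-|move=> <-]; exists x. Qed.

Lemma finite_codim_range_pred f :
  finite_codim_range f -> finite_codim_pred (range_pred f).
Proof.
case=> n [[v2r v2r_lin [r2v v2rK _]]]; exists 'I_n.+1 => x.
pose phi y := v2r (lmod_pi (range_pred f) y).
have phiP a u v : phi (a *: u + v) = a *: phi u + phi v.
  by rewrite /phi linearP v2r_lin.
have phi0 : phi 0 = 0 by have := phiP (-1) 0 0; rewrite !scaleN1r oppr0 addr0 addNr.
pose A := \matrix_(i < n.+1) phi (x i).
(* The coordinates of the [n.+1] vectors form a matrix with only [n] columns, so some nonzero row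
   [c] satisfies [c *m A = 0]. *)
have /rowV0Pn[c /sub_kermxP cA0 c_neq0] : kermx A != 0.
  rewrite -mxrank_eq0 mxrank_ker subn_eq0 -ltnNge.
  by apply: leq_ltn_trans (rank_leq_col A) _.
exists (c 0); first exact/rV0Pn.
rewrite -[X in X \in _]subr0; apply/lmod_pi_eq/(can_inj v2rK); rewrite -!/(phi _) phi0.
rewrite -cA0 mulmx_sum_row.
rewrite (@big_morph _ _ phi 0 +%R 0 +%R) //; last first.
  by move=> u v; rewrite -[u]scale1r phiP !scale1r.
apply: eq_bigr => i _; rewrite rowK -[_ *: x i]addr0 phiP.
by rewrite phi0 addr0.
Qed.

(** Each column [x (_, j)] has a dependence modulo R(f), with value [f u_j]. A dependence of the
    [u_j] modulo R(g) then combines these, and the coefficients multiply. *)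
Lemma finite_codim_pred_comp f g :
  finite_codim_pred (range_pred f) -> finite_codim_pred (range_pred g) ->
  finite_codim_pred (range_pred (f \o g)).
Proof.
move=> [I codim_f] [J codim_g]; exists (I * J)%type => x.
have /choice[h hP] j : exists cu : (I -> F) * V,
    (exists i, cu.1 i != 0) /\ f cu.2 = \sum_i cu.1 i *: x (i, j).
  have [c c0 /range_predP[u fu]] := codim_f (fun i => x (i, j)).
  by exists (c, u).
have [e [j ej] /range_predP[v gv]] := codim_g (fun j => (h j).2).
exists (fun p => e p.2 * (h p.2).1 p.1).
  by have [[i ci] _] := hP j; exists (i, j); rewrite mulf_neq0.
apply/range_predP; exists v; rewrite /= gv linear_sum.
transitivity (\sum_p (e p.2 * (h p.2).1 p.1) *: x (p.1, p.2)); last first.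
  by apply: eq_bigr => -[].
rewrite -(pair_bigA _ (fun i j => (e j * (h j).1 i) *: x (i, j))) /=.
rewrite exchange_big; apply: eq_bigr => k _.
rewrite linearZ /= (hP k).2 scaler_sumr.
by apply: eq_bigr => i _; rewrite scalerA.
Qed.

Lemma iter_rpred (W : {pred V}) (f : V -> V) k x :
  {in W, forall y, f y \in W} -> x \in W -> iter k f x \in W.
Proof. by move=> fW xW; elim: k => //= k IHk; exact: fW. Qed.

Lemma submod_cancel W c x y : c != 0 -> y \in W -> c *: x + y \in W -> x \in W.
Proof.
move=> c0 yW xyW.
have -> : x = c^-1 *: (c *: x + y + -1 *: y).
  by rewrite scaleN1r addrK scalerA mulVf ?scale1r.
by rewrite rpredZ // rpredD // rpredZ.
Qed.

Lemma backward_orbit_rpred W f (b : nat -> V) :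
  finite_codim_pred W -> {in W, forall x, f x \in W} ->
  (forall k, f (b k.+1) = b k) -> f (b 0%N) \in W -> b 0%N \in W.
Proof.
move=> [I codimW] fW fb fb0.
have fbk k l : iter k f (b (k + l)%N) = b l.
  by elim: k l => //= k IHk l; rewrite addSnnS IHk fb.
pose r (i : I) : nat := enum_rank i.
have [c [i0 ci0] cW] := codimW (b \o r).
(* With [r m] the last index in the dependence, [f^(r m)] turns the last term into a multiple of
   [b 0] and every other one into a multiple of an iterate of [f (b 0)], hence into an element of
   [W]. *)
case: (@arg_maxnP _ _ (fun i => c i != 0) r ci0) => m cm maxm.
move: cW => /(iter_rpred (r m) fW); rewrite linear_sum (bigD1 m) //=.
have -> : iter (r m) f (c m *: b (r m)) = c m *: b 0%N.
  by rewrite linearZ /= -{2}[r m]addn0 fbk.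
apply: submod_cancel => //.
apply: rpred_sum => i im; have [->|/maxm ri] := eqVneq (c i) 0.
  by rewrite scale0r linear0 rpred0.
have {}ri : (r i < r m)%N.
  rewrite ltn_neqAle [(_ <= _)%N]ri andbT.
  by apply: contra im => /eqP/ord_inj/enum_rank_inj->.
have -> : iter (r m) f (c i *: b (r i)) =
          c i *: iter (r m - (r i).+1) f (f (b 0%N)).
  by rewrite linearZ /= -(fbk (r i) 0%N) addn0 -iterS -iterD subnK.
by rewrite rpredZ // iter_rpred.
Qed.

Lemma forward_orbit_rpred W f g a :
  finite_codim_pred W -> g \o f =1 f \o g ->
  (forall x, g x = 0 -> f x \in W -> x \in W) -> g a = 0 ->
  exists u w, [/\ g u = 0, w \in W & a = f u + w].
Proof.
move=> [I codimW] gf fW ga.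
have gfk k : g (iter k f a) = 0.
  by elim: k => //= k IHk; rewrite [g _]gf /= IHk linear0.
have fkW k x : g x = 0 -> iter k f x \in W -> x \in W.
  elim: k x => // k IHk x gx; rewrite iterSr => /IHk fxW.
  by apply: fW => //; apply: fxW; rewrite [g _]gf /= gx linear0.
pose r (i : I) : nat := enum_rank i.
have [c [i0 ci0] cW] := codimW (fun i => iter (r i) f a).
(* Now the first index is taken: injectivity of [f] modulo [W] on N(g) cancels [f^(r m)], leaving
   [c m *: a] plus terms in the image of [f]. *)
case: (@arg_minnP _ _ (fun i => c i != 0) r ci0) => m cm minm.
have {}cW : \sum_i c i *: iter (r i - r m) f a \in W.
  apply: (@fkW (r m)).
    by rewrite linear_sum big1 // => i _; rewrite linearZ /= gfk scaler0.
  rewrite linear_sum; congr (_ \in W): cW; apply: eq_bigr => i _.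
  have [->|/minm ri] := eqVneq (c i) 0; first by rewrite !scale0r linear0.
  by rewrite linearZ /= -iterD subnKC.
(* The truncated predecessor is harmless: if [i != m], either [c i = 0] or [r i > r m]. *)
pose u := \sum_(i | i != m) c i *: iter (r i - r m).-1 f a.
have gu : g u = 0.
  by rewrite linear_sum big1 // => i _; rewrite linearZ /= gfk scaler0.
have fu : \sum_i c i *: iter (r i - r m) f a = c m *: a + f u.
  rewrite (bigD1 m) //= subnn; congr (_ + _); rewrite linear_sum.
  apply: eq_bigr => i im; rewrite linearZ /=.
  have [->|/minm ri] := eqVneq (c i) 0; first by rewrite !scale0r.
  rewrite -iterS prednK // subn_gt0 ltn_neqAle ri andbT.
  by apply: contra im => /eqP/ord_inj/enum_rank_inj->.
rewrite fu in cW.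
exists (- (c m)^-1 *: u), ((c m)^-1 *: (c m *: a + f u)); split.
- by rewrite linearZ /= gu scaler0.
- exact: rpredZ.
- by rewrite linearZ /= scalerDr scalerA mulVf // scale1r scaleNr addrC addrK.
Qed.

End FiniteCodimension.

(** * Commuting operators when N(S^n) lies in R(T) *)

Section CommutingOperators.
Variables (F : fieldType) (V : lmodType F) (S T : {linear V -> V}) (n : nat).
Hypothesis ST_comm : S \o T =1 T \o S.
Hypothesis null_cap : forall x, iter n T x = 0 -> iter n S x = 0 -> x = 0.
Hypothesis null_sum : forall x, iter n T (iter n S x) = 0 ->
  exists a b, [/\ x = a + b, iter n T a = 0 & iter n S b = 0].
Hypothesis range_stable : forall x,
  exists y, iter n S (iter n T x) = iter n.+1 S (iter n.+1 T y).
Hypothesis null_range : forall b, iter n S b = 0 -> exists c, b = T c.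

Let W := range_pred (iter n S \o iter n T).

Lemma commS k x : S (iter k T x) = iter k T (S x).
Proof. by elim: k => //= k IHk; rewrite -IHk; exact: ST_comm. Qed.

Lemma commT k x : T (iter k S x) = iter k S (T x).
Proof. by elim: k => //= k IHk; rewrite -IHk; exact/esym/ST_comm. Qed.

Lemma commST j k x : iter j S (iter k T x) = iter k T (iter j S x).
Proof. by elim: j => //= j IHj; rewrite IHj commS. Qed.

Lemma range_pred_iter x : iter n S (iter n T x) \in W.
Proof. by apply/range_predP; exists x. Qed.

Lemma range_predT : {in W, forall w, T w \in W}.
Proof.
move=> _ /range_predP[x <-] /=.
by rewrite commT -iterS iterSr range_pred_iter.
Qed.

Lemma range_pred_preimS w : w \in W -> exists2 v, v \in W & w = S v.
Proof.
move=> /range_predP[x <-] /=; have [y ->] := range_stable x.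
by exists (iter n S (iter n T (T y))); rewrite ?range_pred_iter -?iterSr.
Qed.

Lemma ker_decomp x : exists y a b,
  [/\ x = T (S y) + (a + b), iter n T a = 0 & iter n S b = 0].
Proof.
have [y xy] := range_stable x.
have [|a [b [xab aA bB]]] := null_sum (x := x - T (S y)).
  (* Here [(ST)^n x = (ST)^(n+1) y], so [(ST)^n] kills [x - TSy]. *)
  by rewrite !linearB /= -!commST xy iterSr commS iterSr subrr.
by exists y, a, b; rewrite -xab subrKC.
Qed.

Lemma range_iterT_stable x : exists y, iter n T x = iter n.+1 T y.
Proof.
have [y [a [b [-> aA /null_range[c ->]]]]] := ker_decomp x.
by exists (S y + c); rewrite !linearD /= aA add0r -!iterSr -!iterS.
Qed.

Section PositiveExponent.
Hypothesis n_gt0 : (0 < n)%N.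

Lemma ker_iter_gt0 (f : {linear V -> V}) x : f x = 0 -> iter n f x = 0.
Proof. by move=> fx; case: n n_gt0 => // k _; rewrite iterSr fx linear0. Qed.

(** Any preimage [c] of [b] splits as [a + b'] along A + B. Then [T a = b - T b'] lies in both A and
    B, so it vanishes and [b'] is also a preimage. *)
Lemma null_range_preim b : iter n S b = 0 ->
  exists2 c, iter n S c = 0 & b = T c.
Proof.
move=> bB; have [c bc] := null_range bB.
have [|a [b' [cab aA b'B]]] := null_sum (x := c).
  (* As [n > 0], one factor [T] of [T^n] turns [c] into [b], which [S^n] kills. *)
  case: n n_gt0 bB => // k _; rewrite bc -commST => bB.
  by rewrite commST iterSr commT bB linear0.
exists b' => //; rewrite bc cab linearD /=.
suff -> : T a = 0 by rewrite add0r.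
apply: null_cap; first by rewrite -iterSr iterS aA linear0.
have -> : T a = b - T b' by rewrite bc cab linearD addrK.
by rewrite linearB /= bB -commT b'B linear0 subr0.
Qed.

Lemma iterT_rpredK b : finite_codim_pred W -> iter n S b = 0 ->
  iter n T b \in W -> b \in W.
Proof.
move=> codimW bB.
suff TK c : iter n S c = 0 -> T c \in W -> c \in W.
  move: {1}n; elim=> // k IHk; rewrite iterS => /TK kW; apply/IHk/kW.
  by rewrite commST bB linear0.
(* Iterating [g], a choice of preimages inside B (with dummy value 0 outside B), gives a backward
   [T]-orbit of [c]. *)
have /choice[g gP] x : exists y, iter n S x = 0 -> iter n S y = 0 /\ x = T y.
  have [/null_range_preim[y]|xB] := pselect (iter n S x = 0); first by exists y.
  by exists 0.
move=> cB; have gkB k : iter n S (iter k g c) = 0.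
  by elim: k => //= k /gP[].
apply: (@backward_orbit_rpred _ _ _ _ (fun k => iter k g c)) => //.
  exact: range_predT.
by move=> k /=; have [_ <-] := gP _ (gkB k).
Qed.

(** Write [S x = S e] with [e] in W, and [e = a + b] along A + B. Then [S b] is in both A and B, so
    [S b = 0]; likewise [x - a = 0]. Since [T^n b = T^n e] is in W, so is [b], hence also
    [x = e - b]. *)
Lemma rpredS_ker x : finite_codim_pred W -> iter n T x = 0 ->
  S x \in W -> x \in W.
Proof.
move=> codimW xA /range_pred_preimS[e eW Sxe].
have TSx : iter n T (S x) = 0 by rewrite -commS xA linear0.
have [|a [b [eab aA bB]]] := null_sum (x := e).
  by rewrite -commST; apply: ker_iter_gt0; rewrite commS -Sxe.
have Sxab : S x = S a + S b by rewrite Sxe eab linearD.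
have Sb : S b = 0.
  apply: null_cap; last by rewrite -iterSr iterS bB linear0.
  rewrite -[S b](addKr (S a)) -Sxab linearD linearN /= TSx.
  by rewrite -commS aA linear0 oppr0 addr0.
have xa : x = a.
  apply/eqP; rewrite -subr_eq0; apply/eqP; apply: null_cap.
    by rewrite linearB /= xA aA subrr.
  by apply: ker_iter_gt0; rewrite linearB /= Sxab Sb addr0 subrr.
have bW : b \in W.
  apply: iterT_rpredK => //; rewrite -[b](addKr a) -eab linearD linearN /= aA.
  by rewrite oppr0 add0r; apply: iter_rpred => //; exact: range_predT.
rewrite xa -[a](addrK b) -eab -scaleN1r.
by rewrite rpredD // rpredZ.
Qed.

End PositiveExponent.

Lemma range_iterS_stable x : finite_codim_pred W ->
  exists y, iter n S x = iter n.+1 S y.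
Proof.
move=> codimW; have [n0|n_gt0] := posnP n.
  (* For [n = 0] stability says that [ST] is onto, hence so is [S]. *)
  by have := range_stable x; rewrite n0 /= => -[y ->]; exists (T y).
have [y [a [b [-> aA bB]]]] := ker_decomp x.
(* This gives [a = S u + w]; as S maps W onto W, [w = S v], so [x - b] is in R(S), and [S^n] kills
   [b]. *)
have [|||u [w [uA wW au]]] :=
  @forward_orbit_rpred _ _ W S (iter n T) a codimW => //.
- by move=> z /=; rewrite commS.
- by move=> z zA; exact: rpredS_ker.
have [v _ wv] := range_pred_preimS wW.
exists (T y + u + v); rewrite iterSr !linearD /= bB addr0.
by rewrite au wv linearD /= -[T (S y)]ST_comm addrA.
Qed.

End CommutingOperators.

(** * Descent, and the two cases of the theorem *)

Lemma iter_comp_comm (X : Type) (f g : X -> X) k x :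
  f \o g =1 g \o f -> iter k (f \o g) x = iter k f (iter k g x).
Proof.
move=> fg; elim: k x => //= k IHk x; rewrite IHk; congr f.
elim: k {IHk} (iter k g x) => //= k IHk y.
by rewrite -IHk; exact/esym/fg.
Qed.

Lemma dsc_le_stable (X : Type) (f : X -> X) n :
  (forall x, exists y, iter n f x = iter n.+1 f y) -> dsc_le (dsc f) n.
Proof.
move=> fn; have st : range_stable_at f n.
  apply/asboolP/seteqP; split=> _ [x _ <-].
    by have [y ->] := fn x; exists y.
  by exists (f x); rewrite // -iterSr.
rewrite /dsc; case: pselect => [ex|[]]; last by exists n.
by rewrite /=; case: ex_minnP => m _; apply.
Qed.

Lemma dsc_some_stable (X : Type) (f : X -> X) n x :
  dsc f = Some n -> exists y, iter n f x = iter n.+1 f y.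
Proof.
rewrite /dsc; case: pselect => // ex [<-]; case: ex_minnP => m /asboolP st _.
have : range (iter m f) (iter m f x) by exists x.
by rewrite st => -[y _ <-]; exists y.
Qed.

Lemma dsc_le_commuting (F : fieldType) (V : lmodType F) (S T : {linear V -> V})
    n :
  S \o T =1 T \o S ->
  is_direct_sum (null_space (iter n (T \o S)))
    (null_space (iter n T)) (null_space (iter n S)) ->
  dsc (S \o T) = Some n ->
  null_space (iter n S) `<=` range T ->
  finite_codim_range (iter n S) -> finite_codim_range (iter n T) ->
  dsc_le (dsc T) n /\ dsc_le (dsc S) n.
Proof.
move=> ST_comm [null_eq cap0] dscST BT codimS codimT.
have TS_comm : T \o S =1 S \o T by move=> x; rewrite ST_comm.
have null_cap x : iter n T x = 0 -> iter n S x = 0 -> x = 0.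
  move=> xA xB; suff : [set 0] x by [].
  by rewrite -cap0.
have null_sum x : iter n T (iter n S x) = 0 ->
    exists a b, [/\ x = a + b, iter n T a = 0 & iter n S b = 0].
  rewrite -(iter_comp_comm n x TS_comm) => x0.
  have : null_space (iter n (T \o S)) x by [].
  by rewrite null_eq => -[a aA [b bB <-]]; exists a, b.
have range_stable x :
    exists y, iter n S (iter n T x) = iter n.+1 S (iter n.+1 T y).
  have [y] := dsc_some_stable x dscST.
  rewrite (iter_comp_comm n x ST_comm) (iter_comp_comm n.+1 y ST_comm) => ->.
  by exists y.
have null_range b : iter n S b = 0 -> exists c, b = T c.
  by move=> /BT[c _ <-]; exists c.
have codimW : finite_codim_pred (range_pred (iter n S \o iter n T)).
  by apply: finite_codim_pred_comp; exact: finite_codim_range_pred.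
split; apply: dsc_le_stable => x.
  exact: (range_iterT_stable ST_comm null_sum range_stable null_range).
exact: (range_iterS_stable ST_comm null_cap null_sum range_stable null_range).
Qed.

Theorem theorem1p5 (K : numFieldType) (X : completeNormedModType K)
    (S T : {linear X -> X})
    (bndS : bounded_operator S)
    (bndT : bounded_operator T)
    (ST_comm : S \o T =1 T \o S)
    (null_TS : forall p : nat,
      is_direct_sum (null_space (iter p (T \o S)))
        (null_space (iter p T)) (null_space (iter p S)))
    (n0 : nat) (dsc_ST : dsc (S \o T) = Some n0)
    (null_sub : null_space (iter n0 S) `<=` range T \/
                null_space (iter n0 T) `<=` range S)
    (codimS : finite_codim_range (iter n0 S))
    (codimT : finite_codim_range (iter n0 T)) :
  (dsc_le (dsc T) n0 /\ dsc_le (dsc S) n0) <-> dsc_le (dsc (T \o S)) n0.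
Proof.

have TS_ST : T \o S = S \o T by apply: funext => x; rewrite ST_comm.
(* The right-hand side holds because [TS = ST] has descent [n0]; the bounds on [dsc T] and [dsc S]
   remain. *)
rewrite TS_ST dsc_ST /= leqnn; split=> // _.
case: null_sub => sub; first exact: dsc_le_commuting.
have [null_eq cap0] := null_TS n0.
(* The other inclusion follows by exchanging [S] and [T], the direct sum being symmetric. *)
apply/and_comm; apply: dsc_le_commuting; rewrite ?TS_ST //.
rewrite -TS_ST; split; last by rewrite setIC.
rewrite null_eq; apply/seteqP; split=> _ [a aA [b bB <-]];
  by exists b => //; exists a => //; rewrite addrC.
Qed.
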